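(* Let $\alpha>-1$ and $n\in\mathbb{N}_0$. The Fisher information with respect to the parameter $\alpha$ of the orthonormal Laguerre polynomial $\tilde L_n^{(\alpha)}(x)$, $$I_n^{(L)}(\alpha)=4\int_0^\infty\left\{\frac{\partial}{\partial\alpha}\Big(\big[e^{-x}x^\alpha\big]^{1/2}\tilde L_n^{(\alpha)}(x)\Big)\right\}^2dx,$$ is $$I_n^{(L)}(\alpha)=2\sum_{k=0}^{n-1}\big[\tilde A_k^{(L)}\big]^2-2\frac{\partial\tilde A_n^{(L)}}{\partial\alpha}=\psi^{(1)}(n+\alpha+1)+\frac{2n}{n+\alpha}\,{}_4F_3\left(1,1,1,1-n;\,2,2,1-\alpha-n;\,1\right),$$ where for $n=0$ the second term is read as $0$.
   Context: $\tilde L_n^{(\alpha)}$ is the Laguerre polynomial $L_n^{(\alpha)}$ normalized so that $\int_0^\infty\tilde L_n^{(\alpha)}\tilde L_m^{(\alpha)}e^{-x}x^\alpha dx=\delta_{nm}$, i.e. $\tilde L_n^{(\alpha)}=L_n^{(\alpha)}/d_n$ with $d_n^2=\Gamma(n+\alpha+1)/n!$. $\tilde A_k^{(L)}$ ($0\le k\le n$) are the coefficients in $\frac{\partial}{\partial\alpha}\tilde L_n^{(\alpha)}=\sum_{k=0}^n\tilde A_k^{(L)}\tilde L_k^{(\alpha)}$; explicitly $\tilde A_k^{(L)}=\frac{1}{n-k}\left[\frac{(k+1)_{n-k}}{(k+\alpha+1)_{n-k}}\right]^{1/2}$ for $k<n$ and $\tilde A_n^{(L)}=-\frac12\psi(n+\alpha+1)$.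 Here $\psi=\Gamma'/\Gamma$ is the digamma function, $\psi^{(1)}=\psi'$ is the trigamma function, and $(x)_m$ is the Pochhammer symbol. For $n\ge1$ the hypergeometric series terminates: ${}_4F_3(a_1,\dots,a_4;b_1,b_2,b_3;z)=\sum_{m\ge0}\frac{(a_1)_m\cdots(a_4)_m}{(b_1)_m(b_2)_m(b_3)_m}\frac{z^m}{m!}$ is summed over $0\le m\le n-1$ since $(1-n)_m=0$ for $m\ge n$. *)

(* Defs.v *)
From HB Require Import structures.
From mathcomp Require Import all_boot all_order all_algebra.
From mathcomp Require Import all_classical all_reals all_analysis.
Import Order.TTheory GRing.Theory Num.Theory.
Import numFieldNormedType.Exports.

Set Implicit Arguments.
Unset Strict Implicit.
Unset Printing Implicit Defensive.

Local Open Scope classical_set_scope.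
Local Open Scope ring_scope.

Definition pochhammer (R : realType) (x : R) (m : nat) : R :=
  \prod_(i < m) (x + i%:R).

(* Intended for s > 0, where the integral converges. *)
Definition Gamma (R : realType) (s : R) : R :=
  \int[lebesgue_measure]_(t in `]0, +oo[) (t `^ (s - 1) * expR (- t)).

Definition digamma (R : realType) (s : R) : R := derive1 (@Gamma R) s / Gamma s.

Definition trigamma (R : realType) (s : R) : R := derive1 (@digamma R) s.

(* Generalized hypergeometric series pFq(a; b; z), p and q being the lengths
   of a and b.  In a terminating series, a denominator Pochhammer symbol may
   also vanish beyond the point where the numerator does; such terms are 0
   because x / 0 = 0. *)
Definition hypergeometric (R : realType) (a b : seq R) (z : R) : R :=
  limn (series (fun m : nat =>
    (\prod_(c <- a) pochhammer c m) / (\prod_(c <- b) pochhammer c m)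
      * (z ^+ m / (m`!)%:R))).

(* L_n^(alpha)(x)
     = \sum_(k <= n) (alpha + k + 1)_(n - k) / ((n - k)! k!) (- x) ^ k,
   that is, \sum_(k <= n) binom(n + alpha, n - k) (- x) ^ k / k!. *)
Definition laguerre (R : realType) (n : nat) (alpha x : R) : R :=
  \sum_(k < n.+1) pochhammer (alpha + k%:R + 1) (n - k)
     / ((n - k)`! * k`!)%:R * (- x) ^+ k.

Definition laguerre_norm (R : realType) (n : nat) (alpha : R) : R :=
  Num.sqrt (Gamma (n%:R + alpha + 1) / (n`!)%:R).

Definition olaguerre (R : realType) (n : nat) (alpha x : R) : R :=
  laguerre n alpha x / laguerre_norm n alpha.

(* [laguerreA n k alpha], for k <= n, is the coefficient of the orthonormal
   polynomial of degree k in the expansion of the parameter derivative of the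
   one of degree n.  The polynomials being linearly independent, c 0, ..., c n
   are uniquely determined; the values for k > n are irrelevant. *)
Definition laguerreA (R : realType) (n k : nat) (alpha : R) : R :=
  xget (fun=> 0) [set c : nat -> R | forall x : R,
    derive1 (fun a : R => olaguerre n a x) alpha
      = \sum_(j < n.+1) c j * olaguerre j alpha x] k.

(* Extended-real valued: equality with a finite value includes convergence of
   the integral. *)
Definition laguerre_fisher (R : realType) (n : nat) (alpha : R) : \bar R :=
  (4%:R%:E * \int[@lebesgue_measure R]_(x in `]0%R, +oo[)
     ((derive1 (fun a : R => Num.sqrt (expR (- x) * x `^ a) * olaguerre n a x)
        alpha) ^+ 2)%:E)%E.

(* Main.v *)
(* Write L~_n = sum_i u_(n,i) x^i. Integrating against e^(-x) x^a (ln x)^j turns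
   every integral into a finite sum sum_(i,j) u_i v_j g(a + 1 + i + j) with
   g = Gamma, Gamma' or Gamma'' ([moment_form]), the derivatives of Gamma being
   obtained under the integral sign. Orthogonality of the Laguerre polynomials
   is the vanishing of the n-th finite difference of a polynomial of degree < n,
   and (1 - t)^(-b) gives dL_n/da = sum_(k < n) L_k / (n - k), hence the A_k.
   Write [p, q]_j for the form with g = Gamma^(j), and L' for dL~_n/da.
   Differentiating [L~_n, L~_m]_0 = delta_(n,m) in a gives
   [L~_n, L~_m]_1 = - A_(n,m) - A_(m,n); differentiating
   [L~_n, L~_n]_1 = - 2 A_n in turn gives
   [L~_n, L~_n]_2 = - 2 A_n' - 2 [L', L~_n]_1, and then
   I = [L~_n, L~_n]_2 + 4 [L', L~_n]_1 + 4 [L', L']_0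
     = 2 sum_(k < n) A_k^2 - 2 A_n'.
   Reversed, the sum of the A_k^2 is the terminating 4F3. *)
Require Import Defs.
From HB Require Import structures.
From mathcomp Require Import all_boot all_order all_algebra.
From mathcomp Require Import all_classical all_reals all_analysis.
From mathcomp Require Import measurable_realfun ring lra zify.
Import Order.TTheory GRing.Theory Num.Theory.
Import numFieldNormedType.Exports.

Local Open Scope ring_scope.

Set Implicit Arguments.
Unset Strict Implicit.
Unset Printing Implicit Defensive.

(** * Integrals over the positive half-line *)

Section exhaustion_of_the_half_line.
Context {R : realType}.
Local Notation mu := (@lebesgue_measure R).
Local Notation posR := (`]0%R, +oo[%classic : set R).
Local Open Scope classical_set_scope.

(** Compact segments exhausting the half-line, on which the fundamental theorem of calculus applies.
    The shift by 2 keeps the endpoints distinct already for n = 0. *)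
Definition segment_pos (n : nat) : set R := `[n.+2%:R^-1, n.+2%:R].

Lemma segment_pos_lt (n : nat) : (n.+2%:R^-1 : R) < n.+2%:R.
Proof.
have h : (1 : R) < n.+2%:R by rewrite ltr1n.
by rewrite (lt_trans _ h)// invf_lt1// (lt_trans ltr01).
Qed.

Lemma segment_pos_gt0 (n : nat) (x : R) : segment_pos n x -> 0 < x.
Proof.
rewrite /segment_pos /= in_itv/= => /andP[h _].
by apply: lt_le_trans h; rewrite invr_gt0 ltr0n.
Qed.

Lemma bigcup_segment_pos : \bigcup_n segment_pos n = posR.
Proof.
apply/seteqP; split => [x /= [n _] /segment_pos_gt0 x0|x /=].
  by rewrite in_itv/= x0.
rewrite in_itv/= andbT => x0.
(* A bound on x + 1/x bounds both terms, which yields both endpoint inequalities. *)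
have [n hn] : exists n : nat, x + x^-1 < n%:R.
  exists (Num.bound (x + x^-1)); apply: le_lt_trans (archi_boundP _).
    exact: lexx.
  by rewrite addr_ge0// ltW// invr_gt0.
have x'0 : 0 < x^-1 by rewrite invr_gt0.
have nn : (n%:R : R) <= n.+2%:R by rewrite ler_nat; lia.
exists n => //; rewrite /segment_pos /= in_itv/=; apply/andP; split.
  by rewrite invf_ple ?posrE ?ltr0n//; lra.
by lra.
Qed.

Lemma nondecreasing_segment_pos : nondecreasing_seq segment_pos.
Proof.
move=> m n mn; rewrite subsetEset; apply: subset_itvScc.
  by rewrite bnd_simp lef_pV2 ?posrE ?ltr0n// ler_nat; lia.
by rewrite bnd_simp ler_nat; lia.
Qed.

Lemma measurable_fun_pos (f : R -> R) (D : set R) : measurable D ->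
  (forall x : R, 0 < x -> {for x, continuous f}) -> D `<=` posR ->
  measurable_fun D f.
Proof.
move=> mD cf Dpos.
have mf : measurable_fun posR f.
  apply: open_continuous_measurable_fun; first exact: interval_open.
  by move=> x; rewrite inE/= in_itv/= andbT; exact: cf.
exact: measurable_funS Dpos mf.
Qed.

Lemma integral_segment_pos (f F : R -> R) (n : nat) :
  (forall x : R, 0 < x -> is_derive x 1 F (f x)) ->
  (forall x : R, 0 < x -> {for x, continuous f}) ->
  (\int[mu]_(x in segment_pos n) (f x)%:E
    = (F n.+2%:R - F n.+2%:R^-1)%:E)%E.
Proof.
move=> dF cf; have cF (x : R) : 0 < x -> {for x, continuous F}.
  move=> x0; have [dFx _] := dF x x0.
  exact/differentiable_continuous/derivable1_diffP.
rewrite (@continuous_FTC2 R f F) ?EFinB//; first exact: segment_pos_lt.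
- apply: continuous_in_subspaceT => x; rewrite inE => /segment_pos_gt0.
  exact: cf.
- split.
  + move=> x /subset_itv_oo_cc/segment_pos_gt0 x0.
    by have [] := dF x x0.
  + by apply: cvg_at_right_filter; apply: cF; rewrite invr_gt0.
  + by apply: cvg_at_left_filter; apply: cF.
- move=> x /subset_itv_oo_cc/segment_pos_gt0 x0.
  by rewrite derive1E; have [] := dF x x0.
Qed.

Lemma cvg_integral_segment_pos (f : R -> R) :
  (forall x : R, 0 < x -> {for x, continuous f}) -> (forall x, 0 < x ->
    0 <= f x) ->
  (\int[mu]_(x in segment_pos n) (f x)%:E @[n --> \oo]
    --> \int[mu]_(x in posR) (f x)%:E)%E.
Proof.
move=> cf f0; rewrite -bigcup_segment_pos.
apply: ge0_nondecreasing_set_cvg_integral.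
- exact: nondecreasing_segment_pos.
- by move=> i; exact: measurable_itv.
- move=> i; apply/measurable_EFinP; apply: measurable_fun_pos => //.
    exact: measurable_itv.
  by move=> x xi; rewrite /= in_itv/= andbT (segment_pos_gt0 xi).
- by move=> i x xi; rewrite lee_fin f0// (segment_pos_gt0 xi).
Qed.

(** On each segment the integral is a difference of two values of [F], hence at most 2 M; monotone
    convergence carries the bound to the half-line. *)
Lemma integrable_bounded_primitive (f F : R -> R) (M : R) :
  (forall x : R, 0 < x -> is_derive x 1 F (f x)) ->
  (forall x : R, 0 < x -> {for x, continuous f}) ->
  (forall x : R, 0 < x -> 0 <= f x) -> (forall x, 0 < x -> `|F x| <= M) ->
  mu.-integrable posR (EFin \o f).
Proof.
move=> dF cf f0 FM.
have mf : measurable_fun posR (EFin \o f).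
  by apply/measurable_EFinP; apply: measurable_fun_pos.
apply/integrableP; split => //.
have -> : (\int[mu]_(x in posR) `|(EFin \o f) x| =
    \int[mu]_(x in posR) (f x)%:E)%E.
  apply: eq_integral => x; rewrite inE/= in_itv/= andbT => /f0 fx0.
  by rewrite ger0_norm.
apply: (@le_lt_trans _ _ (M + M)%:E); last exact: ltry.
have cvgI := cvg_integral_segment_pos cf f0.
rewrite -(cvg_lim _ cvgI)//; apply: lime_le; first by apply/cvg_ex; eexists;
  exact: cvgI.
apply: nearW => n; rewrite (integral_segment_pos _ dF cf) lee_fin.
apply: le_trans (ler_norm _) _; apply: le_trans (ler_normB _ _) _.
by rewrite lerD// FM// invr_gt0.
Qed.

End exhaustion_of_the_half_line.

(** * The Gamma function and its derivatives *)

Section gamma_integrand.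
Context {R : realType}.
Local Notation mu := (@lebesgue_measure R).
Local Notation posR := (`]0%R, +oo[%classic : set R).

Lemma exprn_le_expR (n : nat) (x : R) : 0 <= x -> x ^+ n <= n`!%:R * expR x.
Proof.
move=> x0; case: n => [|n].
  by rewrite expr0 fact0 mul1r; apply: le_trans (expR_ge1Dx x); rewrite lerDl.
rewrite mulrC -ler_pdivrMr ?ltr0n ?fact_gt0//.
by apply: le_trans (expR_ge1Dxn n x0); rewrite lerDr.
Qed.

Lemma continuous_powRl (r x : R) : 0 < x -> {for x, continuous (@powR R ^~ r)}.
Proof.
move=> x0; have [+ _] := @is_derive1_powR R r x x0.
by move=> /derivable1_diffP/differentiable_continuous.
Qed.

(* The derivative of the bounded function - 1 / (1 + x ^ r). *)
Definition majorant (r x : R) : R := r * x `^ (r - 1) / (1 + x `^ r) ^+ 2.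

Lemma onepowR_gt0 (r x : R) : 0 < 1 + x `^ r.
Proof. by rewrite ltr_pwDl// powR_ge0. Qed.

Lemma majorant_ge0 (r x : R) : 0 <= r -> 0 <= majorant r x.
Proof.
by move=> r0; rewrite /majorant mulr_ge0 ?mulr_ge0 ?powR_ge0// invr_ge0 sqr_ge0.
Qed.

Lemma is_derive_majorant (r x : R) : 0 < x ->
  is_derive x 1 (fun y => - (1 + y `^ r)^-1) (majorant r x).
Proof.
move=> x0; have n0 : 1 + x `^ r != 0 by rewrite gt_eqF// onepowR_gt0.
have d1 : is_derive x 1 (cst 1 + @powR R ^~ r) (0 + r * x `^ (r - 1)).
  by apply: is_deriveD; exact: is_derive1_powR.
have d2 := is_deriveN (is_deriveV (f := cst 1 + @powR R ^~ r) n0 d1).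
apply: is_derive_eq d2 _.
by rewrite /majorant /= add0r scaleNr opprK /GRing.scale/= mulrC.
Qed.

Lemma continuous_majorant (r x : R) : 0 < x ->
  {for x, continuous (majorant r)}.
Proof.
move=> x0; rewrite /majorant.
apply: (@continuousM _ _ (fun x => r * x `^ (r - 1)) (fun x => (1 + x `^ r)
  ^- 2)).
  by apply: continuousM; [exact: cst_continuous|exact: continuous_powRl].
apply: continuousV; first by rewrite expf_neq0// gt_eqF// onepowR_gt0.
apply: (@continuous_comp _ _ _ (fun x => 1 + x `^ r) (fun y => y ^+ 2)).
  2: exact: exprn_continuous.
by apply: continuousD; [exact: cst_continuous|exact: continuous_powRl].
Qed.

Lemma integrable_majorant (r : R) : 0 <= r ->
  mu.-integrable posR (EFin \o majorant r).
Proof.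
move=> r0; apply: (integrable_bounded_primitive (M := 1)).
- exact: is_derive_majorant.
- exact: continuous_majorant.
- by move=> x _; exact: majorant_ge0.
- move=> x _; rewrite normrN normfV gtr0_norm ?onepowR_gt0//.
  by rewrite invf_le1 ?onepowR_gt0// lerDl powR_ge0.
Qed.

(** The j-th derivative in s of the integrand of Gamma. *)
Definition gamma_kernel (j : nat) (s x : R) : R :=
  x `^ (s - 1) * ln x ^+ j * expR (- x).

(** The left side is r times the quotient of |[gamma_kernel]| by [majorant]. Near 0, x^(s - r) <=
    x^r absorbs the logarithm: with y = - r ln x, x^r |ln x|^j = e^(-y) y^j / r^j <= j! / r^j. The
    factor 4 bounds (1 + x^r)^2. *)
Lemma gamma_kernel_le_near0 (j : nat) (r s x : R) : 0 < r -> 2 * r <= s ->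
  0 < x <= 1 ->
  x `^ (s - r) * `|ln x| ^+ j * expR (- x) * (1 + x `^ r) ^+ 2
    <= 4 * (j`!%:R / r ^+ j).
Proof.
move=> r0 rs /andP[x0 x1].
have xr1 : x `^ r <= 1 by rewrite -(powRr0 x) ger_powR ?x0//; exact: ltW.
have h4 : (1 + x `^ r) ^+ 2 <= 4.
  by have := powR_ge0 x r; nra.
have he : expR (- x) <= 1 by rewrite expR_le1; lra.
have hx : x `^ (s - r) <= x `^ r by rewrite ger_powR ?x0//; lra.
have hl : x `^ r * `|ln x| ^+ j <= j`!%:R / r ^+ j.
  rewrite ler0_norm ?ln_le0//.
  have h : (r * - ln x) ^+ j <= j`!%:R * expR (r * - ln x).
    by apply: exprn_le_expR; rewrite mulr_ge0 ?(ltW r0)// oppr_ge0 ln_le0.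
  have -> : x `^ r = (expR (r * - ln x))^-1.
    by rewrite mulrN expRN invrK /powR gt_eqF.
  rewrite ler_pdivlMr ?exprn_gt0// mulrC mulrCA -exprMn mulrC.
  by rewrite ler_pdivrMr ?expR_gt0.
rewrite mulrC ler_pM ?sqr_ge0//.
  by rewrite !mulr_ge0 ?powR_ge0 ?expR_ge0 ?exprn_ge0.
rewrite -[leRHS]mulr1 ler_pM ?mulr_ge0 ?powR_ge0 ?expR_ge0 ?exprn_ge0//.
apply: le_trans hl; rewrite ler_wpM2r// exprn_ge0//.
Qed.

(** For x >= 1 every factor but the exponential is bounded by a power: x^q for the first, x^j for
    the logarithm, 4 x^(2q) for the square. Together they give 4 x^(3q + j) <= 4 x^N <= 4 N! e^x. *)
Lemma gamma_kernel_le_infty (j N : nat) (r s q x : R) : 0 < r ->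
  2 * r <= s <= q ->
  3 * q + j%:R <= N%:R -> 1 <= x ->
  x `^ (s - r) * `|ln x| ^+ j * expR (- x) * (1 + x `^ r) ^+ 2
    <= 4 * N`!%:R.
Proof.
move=> r0 /andP[rs sq] qN x1.
have x0 : 0 < x by lra.
have hx : x `^ (s - r) <= x `^ q by rewrite ler_powR//; lra.
have hl : `|ln x| ^+ j <= x `^ j%:R.
  rewrite powR_mulrn ?(ltW x0)// lerXn2r ?nnegrE ?normr_ge0 ?(ltW x0)//.
  by rewrite ger0_norm ?ln_ge0// ltW// ln_sublinear.
have hr : 1 + x `^ r <= 2 * x `^ q.
  have : x `^ r <= x `^ q by rewrite ler_powR//; lra.
  have : 1 <= x `^ q by rewrite -(powRr0 x) ler_powR//; lra.
  by lra.
have hr2 : (1 + x `^ r) ^+ 2 <= 4 * (x `^ q * x `^ q).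
  by have := powR_ge0 x r; nra.
have hN : x `^ q * x `^ j%:R * (x `^ q * x `^ q) <= N`!%:R * expR x.
  apply: le_trans (exprn_le_expR N (ltW x0)).
  have xn0 : x != 0 by rewrite gt_eqF.
  rewrite -(powR_mulrn _ (ltW x0)) -!powRD ?xn0 ?implybT//.
  by rewrite ler_powR//; lra.
have p0 := powR_ge0.
rewrite mulrAC expRN ler_pdivrMr ?expR_gt0// -[leRHS]mulrA.
apply: le_trans (_ : 4 * (x `^ q * x `^ j%:R * (x `^ q * x `^ q)) <= _).
  rewrite [leRHS]mulrCA; apply: ler_pM => //.
  - by apply: mulr_ge0; [exact: p0|exact: exprn_ge0].
  - exact: sqr_ge0.
  - by apply: ler_pM => //; exact: p0.
by rewrite ler_pM2l.
Qed.

End gamma_integrand.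

(** * Differentiation of Gamma under the integral sign *)

Section gamma_derivatives.
Context {R : realType}.
Local Notation mu := (@lebesgue_measure R).
Local Notation posR := (`]0%R, +oo[%classic : set R).

(** The constant is uniform for s in [2r, q]: this gives one integrable bound on a whole
    neighbourhood of a parameter, as differentiation under the integral requires. *)
Lemma gamma_kernel_dominated (j : nat) (r q : R) : 0 < r -> exists2 C : R,
  0 <= C & forall s x : R, 2 * r <= s <= q -> 0 < x ->
    `|gamma_kernel j s x| <= C * majorant r x.
Proof.
move=> r0; pose N := Num.bound (3 * `|q| + j%:R).
have hN : 3 * `|q| + j%:R <= N%:R.
  by apply: ltW; apply: le_lt_trans (archi_boundP _); rewrite ?ler_norm.
(* The sum of the bounds for x <= 1 and for x >= 1. *)
pose K : R := 4 * (j`!%:R / r ^+ j) + 4 * N`!%:R.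
have K1 : 0 <= 4 * (j`!%:R / r ^+ j) by rewrite !mulr_ge0// invr_ge0
  exprn_ge0// ltW.
have K2 : 0 <= 4 * (N`!%:R : R) by rewrite mulr_ge0.
exists (K / r); first by rewrite divr_ge0 ?addr_ge0// ltW.
move=> s x /andP[rs sq] x0.
have hK : x `^ (s - r) * `|ln x| ^+ j * expR (- x) * (1 + x `^ r) ^+ 2 <= K.
  have [x1|x1] := leP x 1.
    apply: le_trans (gamma_kernel_le_near0 j r0 rs _) _; first by rewrite x0.
    by rewrite lerDl.
  apply: le_trans (@gamma_kernel_le_infty _ j N r s q x r0 _ _ (ltW x1)) _.
  - by rewrite rs.
  - by apply: le_trans hN; rewrite lerD2r ler_pM2l// ler_norm.
  - by rewrite lerDr.
rewrite /gamma_kernel /majorant !normrM normrX.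
rewrite (ger0_norm (powR_ge0 _ _)) (ger0_norm (expR_ge0 _)).
have -> : s - 1 = (s - r) + (r - 1) by ring.
rewrite powRD; last by rewrite (gt_eqF x0) implybT.
have -> : K / r * (r * x `^ (r - 1) / (1 + x `^ r) ^+ 2)
    = K / (1 + x `^ r) ^+ 2 * x `^ (r - 1).
  have := lt0r_neq0 r0; have := lt0r_neq0 (onepowR_gt0 r x) => u v.
  by field; apply/andP; split.
rewrite -!mulrA mulrCA [leRHS]mulrA [leRHS]mulrC ler_wpM2l ?powR_ge0//.
by rewrite ler_pdivlMr ?exprn_gt0 ?onepowR_gt0// [X in X * _ <= _]mulrA.
Qed.

Lemma continuous_gamma_kernel (j : nat) (s x : R) : 0 < x ->
  {for x, continuous (gamma_kernel j s)}.
Proof.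
move=> x0; rewrite /gamma_kernel.
apply: (@continuousM _ _ (fun x => x `^ (s - 1) * ln x ^+ j) (fun x => expR
  (- x))).
  apply: continuousM; first exact: continuous_powRl.
  apply: (@continuous_comp _ _ _ (@ln R) (fun y => y ^+ j)).
    exact: continuous_ln.
  exact: exprn_continuous.
apply: (@continuous_comp _ _ _ (@GRing.opp R) expR).
  exact: opp_continuous.
exact: continuous_expR.
Qed.

Lemma integrable_gamma_kernel (j : nat) (s : R) : 0 < s ->
  mu.-integrable posR (EFin \o gamma_kernel j s).
Proof.
move=> s0; have r0 : 0 < s / 2 by rewrite divr_gt0.
have [C C0 hC] := gamma_kernel_dominated j s r0.
have mp := @measurable_itv R `]0, +oo[.
apply: (@le_integrable _ _ R mu posR mp _ (fun x => (C * majorant (s / 2)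
  x)%:E)).
- apply/measurable_EFinP; apply: measurable_fun_pos => //.
  exact: continuous_gamma_kernel.
- move=> x; rewrite /= in_itv/= andbT => x0; rewrite lee_fin.
  rewrite [leRHS]ger0_norm; last exact: mulr_ge0 C0 (majorant_ge0 _ (ltW r0)).
  by apply: hC => //; rewrite lexx andbT; lra.
- exact: (@integrableZl _ _ R mu posR mp C _ (integrable_majorant (ltW r0))).
Qed.

Definition gammaD (j : nat) (s : R) : R :=
  \int[mu]_(x in posR) gamma_kernel j s x.

Lemma Gamma_gammaD : @Gamma R = gammaD 0.
Proof.
apply/funext => s; apply: eq_Rintegral => x _.
by rewrite /gamma_kernel expr0 mulr1.
Qed.

Lemma is_derive_gamma_kernel (j : nat) (s x : R) : 0 < x ->
  is_derive s 1 (fun t => gamma_kernel j t x) (gamma_kernel j.+1 s x).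
Proof.
move=> x0.
have -> : (fun t => gamma_kernel j t x) =
    (fun t => (ln x ^+ j * expR (- x)) *: expR ((t - 1) * ln x)).
  apply/funext => t; rewrite /gamma_kernel /powR gt_eqF//.
  by rewrite /GRing.scale/=; ring.
have d : is_derive s 1 (fun t => (t - 1) * ln x) (ln x).
  have -> : (fun t => (t - 1) * ln x) = ln x \*: (id - cst 1).
    by apply/funext => t; rewrite /= mulrC.
  by apply: is_derive_eq; rewrite subr0 /GRing.scale/= mulr1.
have d2 := is_derive1_comp (is_derive_expR _) d.
apply: is_derive_eq (is_deriveZ _ d2) _.
by rewrite /gamma_kernel /powR gt_eqF// /GRing.scale/= exprS; ring.
Qed.

Lemma is_derive_gammaD (j : nat) (s : R) : 0 < s ->
  is_derive s 1 (gammaD j) (gammaD j.+1 s).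
Proof.
have mp := @measurable_itv R `]0, +oo[.
(* The domination is used on the neighbourhood ]s/2, 2s[, so 2r = s/2 and q = 2s. *)
move=> s0; have r0 : 0 < s / 4 by rewrite divr_gt0.
have [C C0 hC] := gamma_kernel_dominated j.+1 (2 * s) r0.
have Is : `]s / 2, 2 * s[%classic s by rewrite /= in_itv/=; apply/andP;
  split; lra.
have intf x : `]s / 2, 2 * s[%classic x ->
    mu.-integrable posR (EFin \o gamma_kernel j x).
  rewrite /= in_itv/= => /andP[h _]; apply: integrable_gamma_kernel.
  by lra.
have dd (x y : R) : 0 < y -> partial1of2 (gamma_kernel j) x y
  = gamma_kernel j.+1 x y.
  move=> y0; rewrite partial1of2E.
  by have [] := is_derive_gamma_kernel j x y0.
have derf1 (x y : R) : `]s / 2, 2 * s[%classic x -> posR y ->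
    derivable (fun t => gamma_kernel j t y) x 1.
  rewrite /= !in_itv/= andbT => _ y0.
  by have [] := is_derive_gamma_kernel j x y0.
have G0 (y : R) : 0 <= C * majorant (s / 4) y.
  exact: mulr_ge0 C0 (majorant_ge0 _ (ltW r0)).
have intG : mu.-integrable posR (EFin \o (fun y => C * majorant (s / 4) y)).
  exact: (@integrableZl _ _ R mu posR mp C _ (integrable_majorant (ltW r0))).
have Gub (x y : R) : `]s / 2, 2 * s[%classic x -> posR y ->
    `|partial1of2 (gamma_kernel j) x y| <= C * majorant (s / 4) y.
  rewrite /= !in_itv/= andbT => /andP[h1 h2] y0; rewrite dd//.
  by apply: hC => //; apply/andP; split; lra.
have d := @derivable_under_integral R _ _ mu _ posR mp _ _ _ Is intf derf1 _
  G0 intG Gub.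
have e := @differentiation_under_integral R _ _ mu _ posR mp _ _ _ Is intf
  derf1 _ G0 intG Gub.
apply: DeriveDef => //; rewrite -derive1E e; apply: eq_Rintegral => y.
by rewrite inE/= in_itv/= andbT => y0; rewrite dd.
Qed.

End gamma_derivatives.

(** * Positivity and functional equation of Gamma *)

Section gamma_function.
Local Open Scope classical_set_scope.
Context {R : realType}.
Local Notation mu := (@lebesgue_measure R).
Local Notation posR := (`]0%R, +oo[%classic : set R).

Lemma EFin_gammaD (j : nat) (s : R) : 0 < s ->
  ((gammaD j s)%:E = \int[mu]_(x in posR) (gamma_kernel j s x)%:E)%E.
Proof.
move=> s0; have mp := @measurable_itv R `]0, +oo[%R.
rewrite /gammaD /Rintegral fineK//.
exact: (@integrable_fin_num _ _ R mu posR mp _ (integrable_gamma_kernel j s0)).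
Qed.

Lemma gamma_kernel0_ge0 (s x : R) : 0 <= gamma_kernel 0 s x.
Proof. by rewrite /gamma_kernel expr0 mulr1 mulr_ge0 ?powR_ge0 ?expR_ge0. Qed.

Lemma Gamma_gt0 (s : R) : 0 < s -> 0 < Gamma s.
Proof.
move=> s0; rewrite Gamma_gammaD -lte_fin EFin_gammaD//.
(* On [segment_pos 0] = [1/2, 2] the integrand is at least [g], whose integral there is explicit and
   positive. *)
pose g (x : R) := expR (- 2) * x `^ (s - 1).
pose G (x : R) := expR (- 2) / s * x `^ s.
have dG (x : R) : 0 < x -> is_derive x 1 G (g x).
  move=> x0; have d := is_deriveZ (expR (- 2) / s) (is_derive1_powR s x0).
  apply: is_derive_eq d _; rewrite /g /GRing.scale/=.
  by have := lt0r_neq0 s0 => ?; field.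
have cg (x : R) : 0 < x -> {for x, continuous g}.
  by move=> x0; apply: continuousM; [exact: cst_continuous|exact:
    continuous_powRl].
have sub : segment_pos 0 `<=` posR.
  by move=> x /segment_pos_gt0 x0; rewrite /= in_itv/= x0.
have ms := @measurable_itv R `[2^-1, 2]%R.
apply: (@lt_le_trans _ _ (\int[mu]_(x in segment_pos 0) (g x)%:E)%E).
  rewrite (integral_segment_pos _ dG cg) lte_fin subr_gt0 ltr_pM2l; last first.
    by rewrite divr_gt0 ?expR_gt0.
  by rewrite gt0_ltr_powR ?nnegrE ?invr_ge0//; exact: segment_pos_lt.
apply: (@le_trans _ _ (\int[mu]_(x in segment_pos 0) (gamma_kernel 0 s
  x)%:E)%E).
  apply: ge0_le_integral => //.
  - by move=> x _; rewrite lee_fin mulr_ge0 ?expR_ge0 ?powR_ge0.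
  - by apply/measurable_EFinP; apply: measurable_fun_pos.
  - apply/measurable_EFinP; apply: measurable_fun_pos => //.
    exact: continuous_gamma_kernel.
  - move=> x; rewrite /segment_pos /= in_itv/= => /andP[_ x2]; rewrite lee_fin.
    rewrite /g /gamma_kernel expr0 mulr1 mulrC ler_wpM2l ?powR_ge0//.
    by rewrite ler_expR lerN2.
apply: ge0_subset_integral => //.
- apply/measurable_EFinP; apply: measurable_fun_pos => //.
  exact: continuous_gamma_kernel.
- by move=> x _; rewrite lee_fin gamma_kernel0_ge0.
Qed.

(** The boundary terms of the integration by parts in [GammaS]. *)
Lemma cvg_powR_expRN_boundary (s : R) : 0 < s ->
  (n.+2%:R `^ s * expR (- n.+2%:R)
    - n.+2%:R^-1 `^ s * expR (- n.+2%:R^-1) @[n --> \oo] --> (0 : R))%classic.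
Proof.
move=> s0; have u0 n : 0 < (n.+2%:R^-1 : R) by rewrite invr_gt0.
have cu : (n.+2%:R^-1 @[n --> \oo] --> (0 : R))%classic.
  have := @cvg_harmonic R; rewrite -(cvg_shiftn 1) => /=.
  by under eq_fun do rewrite addn1.
rewrite -(subr0 0); apply: cvgB.
  (* With s <= N, x^s x <= x^(N+1) <= (N+1)! e^x, so the term at infinity is at most (N+1)! / x. *)
  pose N := Num.bound s.
  have sN : s <= N%:R by apply/ltW/archi_boundP/ltW.
  apply: (@squeeze_cvgr _ _ _ _ (cst 0)
    (fun n => N.+1`!%:R * n.+2%:R^-1)) => /=.
  - apply: nearW => n; rewrite mulr_ge0 ?powR_ge0 ?expR_ge0//=.
    have x1 : (1 : R) <= n.+2%:R by rewrite ler1n.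
    rewrite ler_pdivlMr// expRN mulrAC ler_pdivrMr ?expR_gt0//.
    apply: le_trans (exprn_le_expR N.+1 _) => //.
    by rewrite exprSr ler_wpM2r// -powR_mulrn// ler_powR.
  - exact: cvg_cst.
  - by rewrite -(mulr0 (N.+1`!%:R)); apply: cvgM => //; exact: cvg_cst.
have h : (n.+2%:R^-1 `^ s @[n --> \oo] --> (0 : R))%classic.
  by have /cvg_at_rightP := powR_cvg0 s0; apply.
apply: (@squeeze_cvgr _ _ _ _ (cst 0) (fun n => n.+2%:R^-1 `^ s)) => //=.
  apply: nearW => n; rewrite mulr_ge0 ?powR_ge0 ?expR_ge0//=.
  by rewrite ler_piMr ?powR_ge0// expR_le1 oppr_le0 ltW.
exact: cvg_cst.
Qed.

Lemma GammaS (s : R) : 0 < s -> Gamma (s + 1) = s * Gamma s.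
Proof.
move=> s0; rewrite Gamma_gammaD.
have s10 : 0 < s + 1 by rewrite addr_gt0.
have mp := @measurable_itv R `]0, +oo[%R.
pose F (x : R) := x `^ s * expR (- x).
(* Integration by parts: [f] is the derivative of x^s e^(-x). It changes sign, so the two
   nonnegative kernels are passed to the limit separately. *)
pose f (x : R) := s * gamma_kernel 0 s x - gamma_kernel 0 (s + 1) x.
have dF (x : R) : 0 < x -> is_derive x 1 F (f x).
  move=> x0.
  have d := is_derive1_comp (is_derive_expR _) (is_deriveNid x 1).
  have d2 := is_deriveM (is_derive1_powR s x0) d.
  apply: is_derive_eq d2 _; rewrite /f /gamma_kernel /GRing.scale/= addrK.
  by rewrite expr0; ring.
have cf (x : R) : 0 < x -> {for x, continuous f}.
  move=> x0; apply: continuousB; last exact: continuous_gamma_kernel.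
  by apply: continuousM; [exact: cst_continuous|exact: continuous_gamma_kernel].
have int0 : mu.-integrable posR (fun x => (s * gamma_kernel 0 s x)%:E).
  exact: (@integrableZl _ _ R mu posR mp s _ (integrable_gamma_kernel 0 s0)).
have int1 := integrable_gamma_kernel 0 s10.
have sub n : segment_pos n `<=` posR.
  by move=> x /segment_pos_gt0 x0; rewrite /= in_itv/= x0.
have segE n : (\int[mu]_(x in segment_pos n) (s * gamma_kernel 0 s x)%:E =
    \int[mu]_(x in segment_pos n) (gamma_kernel 0 (s + 1) x)%:E
      + (F n.+2%:R - F n.+2%:R^-1)%:E)%E.
  have ms := @measurable_itv R `[n.+2%:R^-1, n.+2%:R]%R.
  have i0 := @integrableS _ _ R mu posR (segment_pos n) _ mp ms (@sub n) int0.
  have i1 := @integrableS _ _ R mu posR (segment_pos n) _ mp ms (@sub n) int1.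
  rewrite -(integral_segment_pos _ dF cf).
  rewrite (_ : \int[mu]_(x in segment_pos n) (f x)%:E
    = \int[mu]_(x in segment_pos n) (s * gamma_kernel 0 s x)%:E
     - \int[mu]_(x in segment_pos n) (gamma_kernel 0 (s + 1) x)%:E)%E;
       last first.
    by rewrite -integralB//; apply: eq_integral.
  rewrite addeCA subee ?adde0//.
  by apply: integrable_fin_num.
have cF : F n.+2%:R - F n.+2%:R^-1 @[n --> \oo] --> (0 : R).
  exact: cvg_powR_expRN_boundary.
have c0 : (\int[mu]_(x in segment_pos n) (s * gamma_kernel 0 s x)%:E @[n -->
  \oo]
    --> (s * gammaD 0 s)%:E)%E.
  rewrite EFinM EFin_gammaD// -integralZl//; last exact:
    integrable_gamma_kernel.
  apply: cvg_integral_segment_pos => x x0.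
    by apply: continuousM; [exact: cst_continuous|exact:
      continuous_gamma_kernel].
  by rewrite mulr_ge0 ?gamma_kernel0_ge0// ltW.
have c1 : (\int[mu]_(x in segment_pos n) (s * gamma_kernel 0 s x)%:E @[n -->
  \oo]
    --> (gammaD 0 (s + 1))%:E)%E.
  under eq_fun do rewrite segE.
  rewrite -(adde0 (gammaD 0 (s + 1))%:E); apply: cvgeD => //; last first.
    by apply: cvg_EFin; [exact: nearW|exact: cF].
  rewrite EFin_gammaD//.
  apply: cvg_integral_segment_pos => x x0; last exact: gamma_kernel0_ge0.
  exact: continuous_gamma_kernel.
(* The same sequence of integrals has been given two limits, which must agree. *)
have e0 : limn (fun n => \int[mu]_(x in segment_pos n)
  (s * gamma_kernel 0 s x)%:E)%E = _ := cvg_lim (@ereal_hausdorff R) c0.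
have e1 : limn (fun n => \int[mu]_(x in segment_pos n)
  (s * gamma_kernel 0 s x)%:E)%E = _ := cvg_lim (@ereal_hausdorff R) c1.
by apply: EFin_inj; rewrite -e0 -e1.
Qed.

End gamma_function.

(** * The digamma function, Pochhammer symbols and finite differences *)

Section digamma_and_pochhammer.
Context {R : realType}.
Implicit Types s x : R.

Lemma is_derive_Gamma s : 0 < s -> is_derive s 1 (@Gamma R) (gammaD 1 s).
Proof. by move=> s0; rewrite Gamma_gammaD; exact: is_derive_gammaD. Qed.

Lemma digammaE s : 0 < s -> digamma s = gammaD 1 s / Gamma s.
Proof.
by move=> s0; rewrite /digamma derive1E; have [_ ->] := is_derive_Gamma s0.
Qed.

Lemma is_derive_digamma s : 0 < s -> is_derive s 1 (@digamma R) (trigamma s).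
Proof.
move=> s0; rewrite /trigamma derive1E; apply: derivableP.
have G0 := lt0r_neq0 (Gamma_gt0 s0).
have d := is_deriveM (is_derive_gammaD 1 s0) (is_deriveV G0 (is_derive_Gamma
  s0)).
(* The quotient formula for [digamma] is available at positive arguments, hence only near s. *)
have E : \near s, (gammaD 1 * (fun t => (Gamma t)^-1)) s = @digamma R s.
  near=> t; rewrite digammaE//; near: t; exact: lt_nbhsr.
by have [] := near_eq_is_derive E d.
Unshelve. all: end_near. Qed.

Lemma pochhammer0 x : pochhammer x 0 = 1.
Proof. by rewrite /pochhammer big_ord0. Qed.

Lemma pochhammerSr x (m : nat) : pochhammer x m.+1
  = pochhammer x m * (x + m%:R).
Proof. by rewrite /pochhammer big_ord_recr. Qed.

Lemma pochhammerSl x (m : nat) : pochhammer x m.+1 = x * pochhammer (x + 1) m.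
Proof.
rewrite /pochhammer big_ord_recl/= addr0; congr (_ * _).
by apply: eq_bigr => i _; rewrite -addrA nat1r.
Qed.

Lemma pochhammer_gt0 x (m : nat) : 0 < x -> 0 < pochhammer x m.
Proof. by move=> x0; apply: prodr_gt0 => i _; rewrite ltr_wpDr. Qed.

Lemma Gamma_pochhammer x (m : nat) : 0 < x ->
  Gamma (x + m%:R) = pochhammer x m * Gamma x.
Proof.
move=> x0; elim: m => [|m IH]; first by rewrite addr0 pochhammer0 mul1r.
rewrite -natr1 addrA GammaS; last by rewrite ltr_wpDr.
by rewrite IH pochhammerSr; ring.
Qed.

(** Pascal's rule: a finite difference of order n + 1 is one of order n of the first difference. *)
Lemma sum_binS (f : nat -> R) (n : nat) :
  \sum_(i < n.+2) (-1) ^+ i * 'C(n.+1, i)%:R * f i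
    = \sum_(i < n.+1) (-1) ^+ i * 'C(n, i)%:R * (f i - f i.+1).
Proof.
under [RHS]eq_bigr do rewrite mulrBr.
rewrite sumrB big_ord_recl [X in _ = X - _]big_ord_recl /= !bin0 -addrA.
congr (_ + _); under eq_bigr do rewrite binS natrD mulrDr mulrDl.
rewrite big_split/=; congr (_ + _).
  rewrite big_ord_recr/= bin_small// mulr0 mul0r addr0.
  by apply: eq_bigr.
rewrite -sumrN; apply: eq_bigr => i _; rewrite exprS; ring.
Qed.

(** (x + i)_j is a monic polynomial of degree j in i, so its n-th difference vanishes for j < n. The
    induction uses (y)_(j+1) - (y+1)_(j+1) = - (j+1) (y+1)_j. *)
Lemma alternating_sum_pochhammer (n j : nat) x : (j <= n)%N ->
  \sum_(i < n.+1) (-1) ^+ i * 'C(n, i)%:R * pochhammer (x + i%:R) j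
    = (j == n)%:R * ((-1) ^+ n * n`!%:R).
Proof.
elim: n j x => [|n IH] [|j] x //.
- by move=> _; rewrite big_ord1 pochhammer0 !expr0 fact0 !mulr1.
- move=> _; rewrite (sum_binS (fun i => pochhammer (x + i%:R) 0)).
  by rewrite mul0r big1// => i _; rewrite !pochhammer0 subrr mulr0.
rewrite ltnS => jn; rewrite (sum_binS (fun i => pochhammer (x + i%:R) j.+1)).
transitivity (- j.+1%:R * \sum_(i < n.+1)
    (-1) ^+ i * 'C(n, i)%:R * pochhammer (x + 1 + i%:R) j).
  rewrite mulr_sumr; apply: eq_bigr => i _.
  have -> : x + 1 + i%:R = x + i%:R + 1 by ring.
  have -> : x + i.+1%:R = x + i%:R + 1 by rewrite -natr1; ring.
  rewrite pochhammerSl pochhammerSr -natr1; ring.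
rewrite IH// eqSS; case: eqP => [->|_]; last by rewrite !mul0r mulr0.
by rewrite exprS factS natrM; ring.
Qed.

End digamma_and_pochhammer.

(** * Laguerre polynomials and their moments *)

Section laguerre_coefficients.
Context {R : realType}.
Implicit Types a x b : R.

(** Lets polynomials of different degrees be summed over a common range of exponents. *)
Lemma sum_ord_support (u : nat -> R) (n N : nat) : (n < N)%N ->
  (forall i, (n < i)%N -> u i = 0) -> \sum_(i < N) u i = \sum_(i < n.+1) u i.
Proof.
move=> nN u0; rewrite -!(big_mkord xpredT) (big_cat_nat (n := n.+1))//=.
rewrite [X in _ + X]big_nat_cond [X in _ + X]big1 ?addr0// => i.
by rewrite andbT => /andP[ni _]; exact: u0.
Qed.

(** The zero beyond the degree has to be imposed: with truncated subtraction the formula would give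
    (-1)^i / i! for i > n. *)
Definition laguerre_coef (n i : nat) a : R :=
  if (i <= n)%N then
    pochhammer (a + i%:R + 1) (n - i) / ((n - i)`! * i`!)%:R * (-1) ^+ i
  else 0.

Lemma laguerre_coef_gt (n i : nat) a : (n < i)%N -> laguerre_coef n i a = 0.
Proof. by move=> ni; rewrite /laguerre_coef leqNgt ni. Qed.

Lemma laguerreE (n : nat) a x :
  laguerre n a x = \sum_(i < n.+1) laguerre_coef n i a * x ^+ i.
Proof.
apply: eq_bigr => i _; rewrite /laguerre_coef -ltnS ltn_ord.
by rewrite (exprNn x) mulrA.
Qed.

(** The integral of L_n x^j against the weight. One factor (a+1+i)_j splits off Gamma (a+1+i+j), and
    the coefficient turns the remaining Gamma (a+1+i) into Gamma (a+1+n); what is left is an n-th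
    finite difference. *)
Lemma laguerre_moment (n j N : nat) a : (n < N)%N -> (j <= n)%N -> -1 < a ->
  \sum_(i < N) laguerre_coef n i a * Gamma (a + 1 + (i + j)%:R)
    = (j == n)%:R * ((-1) ^+ n * Gamma (a + 1 + n%:R)).
Proof.
move=> nN jn a1.
rewrite (sum_ord_support (u := fun i => laguerre_coef n i a * Gamma (a + 1 +
  (i + j)%:R)) nN); last first.
  by move=> i ni; rewrite laguerre_coef_gt// mul0r.
transitivity (Gamma (a + 1 + n%:R) / n`!%:R * \sum_(i < n.+1)
    (-1) ^+ i * 'C(n, i)%:R * pochhammer (a + 1 + i%:R) j).
  rewrite mulr_sumr; apply: eq_bigr => i _.
  have ai : 0 < a + 1 + i%:R by rewrite ltr_wpDr//; lra.
  have ni : (i <= n)%N by rewrite -ltnS.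
  rewrite /laguerre_coef ni natrD addrA (Gamma_pochhammer j ai).
  have -> : a + 1 + n%:R = a + 1 + i%:R + (n - i)%:R.
    by rewrite natrB//; ring.
  rewrite (Gamma_pochhammer _ ai).
  have -> : a + i%:R + 1 = a + 1 + i%:R by ring.
  rewrite -(bin_fact ni) !natrM.
  have f0 k : (k`!%:R : R) != 0 by rewrite pnatr_eq0 -lt0n fact_gt0.
  have b0 : ('C(n, i)%:R : R) != 0 by rewrite pnatr_eq0 -lt0n bin_gt0.
  by field; rewrite !f0 b0.
rewrite alternating_sum_pochhammer//.
have f0 : (n`!%:R : R) != 0 by rewrite pnatr_eq0 -lt0n fact_gt0.
by field.
Qed.

(* The inner product of u and v, seen as polynomials of degree < N, for the
   weight with moments [g (a + 1 + k)]; [g] is a derivative of Gamma. *)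
Definition moment_form (N : nat) (g : R -> R) a (u v : nat -> R) : R :=
  \sum_(i < N) \sum_(j < N) u i * v j * g (a + 1 + (i + j)%:R).

Lemma moment_formC (N : nat) (g : R -> R) a (u v : nat -> R) :
  moment_form N g a u v = moment_form N g a v u.
Proof.
rewrite /moment_form exchange_big/=; apply: eq_bigr => i _.
by apply: eq_bigr => j _; rewrite addnC (mulrC (u j)).
Qed.

Lemma moment_form_suml (N K : nat) (g : R -> R) a (c : 'I_K -> R)
    (u : 'I_K -> nat -> R) (v : nat -> R) :
  moment_form N g a (fun i => \sum_(k < K) c k * u k i) v
    = \sum_(k < K) c k * moment_form N g a (u k) v.
Proof.
under [RHS]eq_bigr do rewrite mulr_sumr.
rewrite [RHS]exchange_big/=; apply: eq_bigr => i _.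
under [RHS]eq_bigr do rewrite mulr_sumr.
rewrite [RHS]exchange_big/=; apply: eq_bigr => j _.
by rewrite !mulr_suml; apply: eq_bigr => k _; rewrite !mulrA.
Qed.

(** L_n has zero moment against x^j for j < n, so only the coefficient of x^n in L_m counts. It is 0
    for m < n and (-1)^n / n! for m = n. *)
Lemma laguerre_coef_orthogonal (n m N : nat) a : (m <= n < N)%N -> -1 < a ->
  moment_form N (@Gamma R) a (laguerre_coef n ^~ a) (laguerre_coef m ^~ a)
    = (m == n)%:R * (Gamma (a + 1 + n%:R) / n`!%:R).
Proof.
move=> /andP[mn nN] a1; rewrite /moment_form exchange_big/=.
transitivity (\sum_(j < N) laguerre_coef m j a *
    ((j == n :> nat)%:R * ((-1) ^+ n * Gamma (a + 1 + n%:R)))).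
  apply: eq_bigr => j _; have [jm|mj] := leqP j m; last first.
    by rewrite laguerre_coef_gt// mul0r big1// => i _; rewrite mulr0 mul0r.
  rewrite -(laguerre_moment nN (leq_trans jm mn) a1) mulr_sumr.
  by apply: eq_bigr => i _; ring.
rewrite (bigD1 (Ordinal nN))//= [X in _ + X]big1 ?addr0; last first.
  move=> j /negP jn; rewrite (_ : (j == n :> nat) = false) ?mul0r ?mulr0//.
  by apply/negP => /eqP h; apply: jn; apply/eqP/val_inj.
rewrite eqxx mul1r; have [->|mneq] := eqVneq m n; last first.
  by rewrite laguerre_coef_gt ?mul0r// ltn_neqAle mneq.
rewrite /laguerre_coef leqnn subnn pochhammer0 fact0 mul1n mul1r.
have f0 : (n`!%:R : R) != 0 by rewrite pnatr_eq0 -lt0n fact_gt0.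
have sgn2 : (-1) ^+ n * (-1) ^+ n = 1 :> R.
  by rewrite -exprMn mulrNN mulr1 expr1n.
transitivity ((-1) ^+ n * (-1) ^+ n * (Gamma (a + 1 + n%:R) / n`!%:R)).
  by field.
by rewrite sgn2 mul1r.
Qed.

Lemma laguerre_norm_gt0 (n : nat) a : -1 < a -> 0 < laguerre_norm n a.
Proof.
move=> a1; rewrite /laguerre_norm sqrtr_gt0 divr_gt0 ?ltr0n ?fact_gt0//.
by apply: Gamma_gt0; have := ler0n R n; lra.
Qed.

Lemma sqr_laguerre_norm (n : nat) a : -1 < a ->
  laguerre_norm n a ^+ 2 = Gamma (a + 1 + n%:R) / n`!%:R.
Proof.
move=> a1; have -> : a + 1 + n%:R = n%:R + a + 1 by ring.
rewrite sqr_sqrtr// divr_ge0//.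
by apply/ltW/Gamma_gt0; have := ler0n R n; lra.
Qed.

Definition olaguerre_coef (n i : nat) a : R :=
  laguerre_coef n i a / laguerre_norm n a.

Lemma olaguerre_coef_gt (n i : nat) a : (n < i)%N -> olaguerre_coef n i a = 0.
Proof. by move=> ni; rewrite /olaguerre_coef laguerre_coef_gt// mul0r. Qed.

Lemma olaguerreE (n N : nat) a x : (n < N)%N ->
  olaguerre n a x = \sum_(i < N) olaguerre_coef n i a * x ^+ i.
Proof.
move=> nN; rewrite (sum_ord_support (u := fun i => olaguerre_coef n i a * x
  ^+ i) nN).
  rewrite /olaguerre laguerreE mulr_suml.
  by apply: eq_bigr => i _; rewrite mulrAC.
by move=> i ni; rewrite olaguerre_coef_gt// mul0r.
Qed.

Lemma moment_formZ (N : nat) (g : R -> R) a (c d : R) (u v : nat -> R) :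
  moment_form N g a (fun i => u i * c) (fun i => v i * d)
    = moment_form N g a u v * (c * d).
Proof.
rewrite /moment_form mulr_suml; apply: eq_bigr => i _.
by rewrite mulr_suml; apply: eq_bigr => j _; ring.
Qed.

Lemma olaguerre_coef_orthonormal (n m N : nat) a : (n < N)%N -> (m < N)%N ->
  -1 < a ->
  moment_form N (@Gamma R) a (olaguerre_coef n ^~ a) (olaguerre_coef m ^~ a)
    = (n == m)%:R.
Proof.
wlog mn : n m / (m <= n)%N.
  move=> wl nN mN a1; have [mn|/ltnW nm] := leqP m n; first exact: wl.
  by rewrite moment_formC wl// eq_sym.
move=> nN mN a1; rewrite moment_formZ laguerre_coef_orthogonal ?mn// eq_sym.
rewrite -sqr_laguerre_norm//; case: eqP => [<-|_]; last by rewrite !mul0r.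
by have := lt0r_neq0 (laguerre_norm_gt0 n a1) => h; rewrite mulr1n; field.
Qed.

End laguerre_coefficients.

(** * Differentiation of the polynomials in the parameter *)

Section parameter_derivative.
Context {R : realType}.
Implicit Types a b x : R.

(** The coefficient of t^m in (1 - t)^(-b). *)
Definition rising (m : nat) b : R := pochhammer b m / m`!%:R.

Lemma risingS (m : nat) b : rising m.+1 b = rising m b * (b + m%:R) / m.+1%:R.
Proof.
rewrite /rising pochhammerSr factS natrM invfM.
have f0 : (m`!%:R : R) != 0 by rewrite pnatr_eq0 -lt0n fact_gt0.
have m0 : (m.+1%:R : R) != 0 by [].
by field; rewrite nat1r m0 f0.
Qed.

(* In terms of generating functions:
   d/db (1 - t)^(-b) = - ln (1 - t) * (1 - t)^(-b). *)
Lemma is_derive_rising (m : nat) b :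
  is_derive b 1 (rising m) (\sum_(j < m) rising j b / (m - j)%:R).
Proof.
elim: m => [|m IH].
  have -> : rising 0 = cst 1.
    by apply/funext => y; rewrite /rising pochhammer0 fact0 divr1.
  by rewrite big_ord0; exact: is_derive_cst.
have -> : rising m.+1 = m.+1%:R^-1 \*: (rising m * (id + cst m%:R)).
  by apply/funext => y; rewrite risingS /= mulrC.
have d := is_deriveZ m.+1%:R^-1
  (is_deriveM IH (is_deriveD (is_derive_id b 1) (is_derive_cst (m%:R :
    R) b 1))).
apply: is_derive_eq d _; rewrite /GRing.scale/= addr0 mulr1.
have m0 : (m.+1%:R : R) != 0 by [].
apply: (mulfI m0); rewrite mulrA divff// mul1r.
(* After multiplication by m + 1, each term is split by (m+1) / (m+1-j) = 1 + j / (m+1-j); the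
   second sum has no term at j = 0 and is shifted by one. *)
transitivity (\sum_(j < m.+1) rising j b
    + \sum_(j < m) j.+1%:R * rising j.+1 b / (m - j)%:R); last first.
  have -> : \sum_(j < m) j.+1%:R * rising j.+1 b / (m - j)%:R
      = \sum_(j < m.+1) j%:R * rising j b / (m.+1 - j)%:R.
    by rewrite [RHS]big_ord_recl/= mul0r mul0r add0r.
  rewrite -big_split/= mulr_sumr; apply: eq_bigr => j _.
  have jm : (j <= m.+1)%N by rewrite ltnW.
  have d0 : (m.+1 - j)%:R != 0 :> R by rewrite pnatr_eq0 subn_eq0 -ltnNge.
  move: d0; rewrite natrB// => d0; field.
  by rewrite nat1r.
rewrite big_ord_recr/= [RHS]addrAC [RHS]addrC; congr (_ + _).
rewrite mulr_sumr -big_split/=; apply: eq_bigr => j _.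
have jm : (j <= m)%N by rewrite ltnW.
have d0 : (m - j)%:R != 0 :> R by rewrite pnatr_eq0 subn_eq0 -ltnNge.
have j0 : (j.+1%:R : R) != 0 by [].
rewrite risingS natrB//; move: d0; rewrite natrB// => d0.
rewrite [(id + _) b](_ : _ = b + m%:R)//; field.
by rewrite nat1r d0 j0.
Qed.

Lemma laguerre_coef_rising (n i : nat) a : (i <= n)%N ->
  laguerre_coef n i a = (-1) ^+ i / i`!%:R * rising (n - i) (a + (i%:R + 1)).
Proof.
move=> ni; rewrite /laguerre_coef ni /rising natrM addrA.
have f0 k : (k`!%:R : R) != 0 by rewrite pnatr_eq0 -lt0n fact_gt0.
by field; rewrite !f0.
Qed.

(** The coefficient of x^i is [rising (n - i)] at a shifted argument, times a factor independent of
    n. The terms with k < i vanish and k = i + j reindexes the others. *)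
Lemma is_derive_laguerre_coef (n i : nat) a :
  is_derive a 1 (laguerre_coef n i)
    (\sum_(k < n) laguerre_coef k i a / (n - k)%:R).
Proof.
have [ni|ni] := leqP i n; last first.
  have -> : @laguerre_coef R n i = cst (0 : R).
    by apply/funext => y; rewrite laguerre_coef_gt.
  rewrite big1 => [|k _]; first exact: is_derive_cst.
  by rewrite laguerre_coef_gt ?mul0r// (ltn_trans (ltn_ord k)).
have -> : @laguerre_coef R n i =
    ((-1) ^+ i / i`!%:R) \*: (rising (n - i) \o shift (i%:R + 1)).
  by apply/funext => y; rewrite laguerre_coef_rising.
have d := is_deriveZ ((-1) ^+ i / i`!%:R)
  (is_derive1_comp (is_derive_rising (n - i) (shift (i%:R + 1) a))
    (is_derive_shift a 1 (i%:R + 1))).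
apply: is_derive_eq d _; rewrite /GRing.scale/= mulr1.
rewrite -(big_mkord xpredT (fun k => laguerre_coef k i a / (n - k)%:R)).
rewrite (big_cat_nat (n := i))//= [X in _ = X + _]big_nat_cond.
rewrite [X in _ = X + _]big1 ?add0r; last first.
  by move=> k /andP[/andP[_ ki] _]; rewrite laguerre_coef_gt ?mul0r.
rewrite [RHS](_ : _ = \sum_(0 + i <= k < n) laguerre_coef k i a / (n - k)%:R)//.
rewrite big_addn big_mkord mulr_sumr; apply: eq_bigr => k _.
rewrite laguerre_coef_rising ?leq_addl// addnK subnDA -subnDA addnC subnDA
  mulrA.
by [].
Qed.

Lemma is_derive_laguerre_norm (n : nat) a : -1 < a ->
  is_derive a 1 (@laguerre_norm R n)
    (digamma (n%:R + a + 1) / 2 * laguerre_norm n a).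
Proof.
move=> a1; have na : 0 < n%:R + a + 1 by have := ler0n R n; lra.
have G0 := Gamma_gt0 na; have gn0 := lt0r_neq0 G0.
have f0 : (n`!%:R : R) != 0 by rewrite pnatr_eq0 -lt0n fact_gt0.
pose f (y : R) := n%:R + y + 1.
have df : is_derive a 1 f 1.
  have -> : f = shift (n%:R + 1) by apply/funext => y; rewrite /f /=; ring.
  exact: is_derive_shift.
have -> : @laguerre_norm R n = Num.sqrt \o (n`!%:R^-1 \*: (@Gamma R \o f)).
  by apply/funext => y; rewrite /laguerre_norm /= mulrC.
have d1 := is_deriveZ n`!%:R^-1
  (is_derive1_comp (is_derive_Gamma (na : 0 < f a)) df).
have p0 : 0 < (n`!%:R^-1 \*: (@Gamma R \o f)) a.
  by rewrite /= /GRing.scale/= mulr_gt0// invr_gt0 ltr0n fact_gt0.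
have d2 := is_derive1_comp (is_derive1_sqrt p0) d1.
apply: is_derive_eq d2 _; rewrite digammaE// /GRing.scale/= mulr1 -/(f a).
have -> : Num.sqrt (n`!%:R^-1 * Gamma (f a)) = laguerre_norm n a.
  by rewrite mulrC.
have s0 := lt0r_neq0 (laguerre_norm_gt0 n a1).
have -> : Gamma (f a) = laguerre_norm n a ^+ 2 * n`!%:R.
  have fE : f a = a + 1 + n%:R by rewrite /f; ring.
  by rewrite sqr_laguerre_norm// divfK// fE.
by field; rewrite s0 f0.
Qed.

(** The closed form of A_k, shown equal to [laguerreA] in [laguerreAE]. The ratio of norms comes
    from normalizing L_k / (n - k); the value 0 for k > n allows sums over any range containing
    n. *)
Definition laguerre_connection (n k : nat) a : R :=
  if (k < n)%N then laguerre_norm k a / laguerre_norm n a / (n - k)%:R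
  else if k == n then - (digamma (n%:R + a + 1) / 2) else 0.

Lemma is_derive_olaguerre_coef (n N i : nat) a : (n < N)%N -> -1 < a ->
  is_derive a 1 (olaguerre_coef n i)
    (\sum_(k < N) laguerre_connection n k a * olaguerre_coef k i a).
Proof.
move=> nN a1; have s0 k := lt0r_neq0 (laguerre_norm_gt0 k a1).
rewrite (sum_ord_support
  (u := fun k => laguerre_connection n k a * olaguerre_coef k i a) nN);
    last first.
  move=> k nk; rewrite /laguerre_connection ltnNge ltnW//=.
  by rewrite gtn_eqF// mul0r.
have d := is_deriveM (is_derive_laguerre_coef n i a)
  (is_deriveV (s0 n) (is_derive_laguerre_norm n a1)).
(* In the product rule for L_n / d_n, the derivative of 1 / d_n supplies the term k = n and that of
   L_n the terms k < n. *)
apply: is_derive_eq d _; rewrite /GRing.scale/= big_ord_recr/= addrC.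
rewrite /laguerre_connection ltnn eqxx; congr (_ + _).
  by rewrite /olaguerre_coef; field; rewrite s0.
rewrite mulr_sumr; apply: eq_bigr => k _; rewrite ltn_ord /olaguerre_coef.
have d0 : (n - k)%:R != 0 :> R by rewrite pnatr_eq0 subn_eq0 -ltnNge.
by field; rewrite !s0 d0.
Qed.

Lemma is_derive_olaguerre (n N : nat) a x : (n < N)%N -> -1 < a ->
  is_derive a 1 (fun b => olaguerre n b x)
    (\sum_(k < N) laguerre_connection n k a * olaguerre k a x).
Proof.
move=> nN a1.
have -> : (fun b => olaguerre n b x) =
    \sum_(i < N) (x ^+ i \*: olaguerre_coef n i).
  apply/funext => b; rewrite (olaguerreE _ _ nN) fct_sumE.
  by apply: eq_bigr => i _; rewrite /= mulrC.
have d := is_derive_sum (fun i : 'I_N =>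
  is_deriveZ (x ^+ i) (is_derive_olaguerre_coef i nN a1)).
apply: is_derive_eq d _; rewrite /GRing.scale/=.
under [RHS]eq_bigr => k _ do rewrite (olaguerreE _ _ (ltn_ord k)) mulr_sumr.
rewrite exchange_big/=; apply: eq_bigr => i _.
by rewrite mulr_sumr; apply: eq_bigr => k _; rewrite mulrC mulrA.
Qed.

(** A nonzero polynomial would have the distinct roots 0, ..., [size q] - 1, one more than its
    degree. *)
Lemma poly_fun_eq0 (N : nat) (p : nat -> R) :
  (forall x : R, \sum_(i < N) p i * x ^+ i = 0) ->
  forall i, (i < N)%N -> p i = 0.
Proof.
move=> p0 i iN; pose q := \poly_(i < N) p i.
suff q0 : q = 0 by have := coef_poly N p i; rewrite -/q q0 coef0 iN.
apply/eqP/negP => /negP q0.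
have := @max_poly_roots _ q [seq i%:R | i <- iota 0 (size q)] q0.
rewrite size_map size_iota ltnn => h; apply: notF; apply: h.
  by apply/allP => y _; rewrite /root horner_poly p0.
rewrite map_inj_uniq ?iota_uniq// => u v /eqP.
by rewrite eqr_nat => /eqP.
Qed.

End parameter_derivative.

(** * Relations between the moment forms for Gamma, Gamma' and Gamma'' *)

Section moment_relations.
Context {R : realType}.
Implicit Types a b x : R.

(** The difference of the two sums has zero coefficients; pairing it with the k-th orthonormal
    polynomial isolates c k - d k. *)
Lemma sum_diff_olaguerre_eq0 (N : nat) (c d : nat -> R) a : -1 < a ->
  (forall x, \sum_(j < N) c j * olaguerre j a x
     = \sum_(j < N) d j * olaguerre j a x) ->
  forall k, (k < N)%N -> c k = d k.
Proof.
move=> a1 cd k kN; apply/eqP; rewrite -subr_eq0; apply/eqP.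
pose p i := \sum_(j < N) (c j - d j) * olaguerre_coef j i a.
have p0 i : (i < N)%N -> p i = 0.
  apply: (@poly_fun_eq0 _ N p) => x; apply/eqP.
  move: (cd x) => /eqP; rewrite -subr_eq0 -sumrB; congr (_ == 0).
  under eq_bigr => j _ do rewrite (olaguerreE _ _ (ltn_ord j)) -mulrBl
    mulr_sumr.
  rewrite exchange_big/=; apply: eq_bigr => i' _.
  by rewrite mulr_suml; apply: eq_bigr => j _; rewrite mulrA.
have := moment_form_suml N (@Gamma R) a (fun j : 'I_N => c j - d j)
  (fun j i => olaguerre_coef j i a) (olaguerre_coef k ^~ a).
rewrite /moment_form big1 => [|i _]; last first.
  by rewrite big1// => j _; rewrite [X in X * _ * _]p0// !mul0r.
rewrite -/(moment_form _ _ _ _ _) => e; rewrite [RHS]e.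
rewrite (bigD1 (Ordinal kN))//= [X in _ = _ + X]big1 ?addr0.
  by rewrite [X in _ * X]olaguerre_coef_orthonormal// eqxx mulr1.
move=> j jk; rewrite [X in _ * X]olaguerre_coef_orthonormal//.
rewrite (_ : (j == k :> nat) = false) ?mulr0//.
by apply/negP => /eqP h; move/negP: jk; apply; apply/eqP/val_inj.
Qed.

Lemma laguerreAE (n k : nat) a : -1 < a -> (k <= n)%N ->
  laguerreA n k a = laguerre_connection n k a.
Proof.
move=> a1 kn; rewrite /laguerreA.
case: xgetP => [c _ /= hc|]; last first.
  (* The closed form inhabits the set, so the default of [xget] is never taken. *)
  move/(_ (laguerre_connection n ^~ a)) => /= [] x; rewrite derive1E.
  by have [_ ->] := is_derive_olaguerre x (ltnSn n) a1.
apply: (@sum_diff_olaguerre_eq0 n.+1 c (laguerre_connection n ^~ a) a a1) =>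
  // x.
rewrite -hc derive1E.
by have [_ ->] := is_derive_olaguerre x (ltnSn n) a1.
Qed.

(** The product rule; with [dg] the next derivative of Gamma, the last term is the derivative of the
    weight x^a, which inserts a factor ln x. *)
Lemma is_derive_moment_form (N : nat) (g dg : R -> R) a (u v : nat -> R -> R)
    (du dv : nat -> R) : -1 < a ->
  (forall i, is_derive a 1 (u i) (du i)) ->
  (forall i, is_derive a 1 (v i) (dv i)) ->
  (forall s : R, 0 < s -> is_derive s 1 g (dg s)) ->
  is_derive a 1 (fun b => moment_form N g b (u ^~ b) (v ^~ b))
    (moment_form N g a du (v ^~ a) + moment_form N g a (u ^~ a) dv
     + moment_form N dg a (u ^~ a) (v ^~ a)).
Proof.
move=> a1 hu hv hg.
have dgs k : is_derive a 1 (g \o shift (1 + k%:R)) (dg (a + 1 + k%:R)).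
  have p : 0 < shift (1 + k%:R) a by rewrite /=; have := ler0n R k; lra.
  apply: is_derive_eq (is_derive1_comp (hg _ p) (is_derive_shift a 1 (1 +
    k%:R))) _.
  by rewrite /= mulr1 addrA.
have -> : (fun b => moment_form N g b (u ^~ b) (v ^~ b)) =
    \sum_(i < N) \sum_(j < N) (u i * v j * (g \o shift (1 + (i + j)%:R))).
  apply/funext => b; rewrite fct_sumE; apply: eq_bigr => i _.
  by rewrite fct_sumE; apply: eq_bigr => j _; rewrite -addrA.
have d := is_derive_sum (fun i : 'I_N => is_derive_sum (fun j : 'I_N =>
  is_deriveM (is_deriveM (hu i) (hv j)) (dgs (i + j)%N))).
apply: is_derive_eq d _; rewrite /moment_form -!big_split/=.
apply: eq_bigr => i _; rewrite -!big_split/=; apply: eq_bigr => j _.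
rewrite /GRing.scale/= addrA.
rewrite [(u i * v j) a](_ : _ = u i a * v j a)//; ring.
Qed.

(** By orthonormality, pairing the derivative of L~_k with L~_m reads off its m-th coefficient. *)
Lemma moment_form_connection (k m K : nat) b : (k < K)%N -> (m < K)%N ->
  -1 < b ->
  moment_form K (@Gamma R) b
    (fun i => \sum_(l < K) laguerre_connection k l b * olaguerre_coef l i b)
    (olaguerre_coef m ^~ b) = laguerre_connection k m b.
Proof.
move=> kK mK b1.
rewrite (moment_form_suml K (@Gamma R) b
  (fun l : 'I_K => laguerre_connection k l b) (fun l i => olaguerre_coef l i
    b)).
rewrite (bigD1 (Ordinal mK))//= [X in _ + X]big1 ?addr0.
  by rewrite [X in _ * X]olaguerre_coef_orthonormal// eqxx mulr1.
move=> j jk; rewrite [X in _ * X]olaguerre_coef_orthonormal//.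
rewrite (_ : (j == m :> nat) = false) ?mulr0//.
by apply/negP => /eqP h; move/negP: jk; apply; apply/eqP/val_inj.
Qed.

Lemma moment_form_gammaD1 (n m N : nat) a : (n < N)%N -> (m < N)%N -> -1 < a ->
  moment_form N (gammaD 1) a (olaguerre_coef n ^~ a) (olaguerre_coef m ^~ a)
    = - laguerre_connection n m a - laguerre_connection m n a.
Proof.
move=> nN mN a1.
have d := is_derive_moment_form N (u := olaguerre_coef n) (v :=
  olaguerre_coef m)
  a1 (fun i => is_derive_olaguerre_coef i nN a1)
  (fun i => is_derive_olaguerre_coef i mN a1) (@is_derive_Gamma R).
(* Orthonormality is known for parameters above -1, so the form is constant near a and its
   derivative is 0. *)
have E : \near a, moment_form N (@Gamma R) a (olaguerre_coef n ^~ a)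
    (olaguerre_coef m ^~ a) = cst ((n == m)%:R : R) a.
  near=> b; rewrite [LHS]olaguerre_coef_orthonormal//.
  by near: b; exact: lt_nbhsr.
have [_] := near_eq_is_derive E d; rewrite derive_cst.
rewrite [X in X + _ + _]moment_form_connection//.
rewrite [X in _ + X + _]moment_formC [X in _ + X + _]moment_form_connection//.
by move=> /esym/eqP; rewrite addrC addr_eq0 => /eqP ->; rewrite opprD.
Unshelve. all: end_near. Qed.

(** For n < N, the coefficient of x^i in dL~_n/da. *)
Definition laguerre_coef_derivative (n N i : nat) a : R :=
  \sum_(k < N) laguerre_connection n k a * olaguerre_coef k i a.

(** Parseval's identity. The term k = n is kept apart because it cancels against
    [moment_form_gammaD1_d] in the Fisher information. *)
Lemma moment_form_gammaD0_dd (n : nat) a : -1 < a ->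
  moment_form n.+1 (gammaD 0) a (laguerre_coef_derivative n n.+1 ^~ a)
     (laguerre_coef_derivative n n.+1 ^~ a)
  = \sum_(k < n) laguerre_connection n k a ^+ 2 + laguerre_connection n n a
    ^+ 2.
Proof.
move=> a1; rewrite -Gamma_gammaD.
rewrite [LHS](moment_form_suml n.+1 (@Gamma R) a
  (fun l : 'I_n.+1 => laguerre_connection n l a) (fun l i => olaguerre_coef l
    i a)).
transitivity (\sum_(k < n.+1) laguerre_connection n k a ^+ 2); last first.
  by rewrite big_ord_recr.
apply: eq_bigr => k _; rewrite moment_formC [X in _ *
  X]moment_form_connection//.
Qed.

Lemma moment_form_gammaD1_d (n : nat) a : -1 < a ->
  moment_form n.+1 (gammaD 1) a (laguerre_coef_derivative n n.+1 ^~ a)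
     (olaguerre_coef n ^~ a)
  = - (\sum_(k < n) laguerre_connection n k a ^+ 2)
     - 2 * laguerre_connection n n a ^+ 2.
Proof.
move=> a1.
rewrite [LHS](moment_form_suml n.+1 (gammaD 1) a
  (fun l : 'I_n.+1 => laguerre_connection n l a) (fun l i => olaguerre_coef l
    i a)).
rewrite big_ord_recr/= [X in _ + _ * X]moment_form_gammaD1//; congr (_ + _);
  last by ring.
rewrite -sumrN; apply: eq_bigr => k _.
rewrite [X in _ * X]moment_form_gammaD1//; last by rewrite ltnW// ltnS.
(* For k < n the derivative of L~_k has no component along L~_n. *)
rewrite {2}/laguerre_connection ltnNge ltnW//= gtn_eqF//; ring.
Qed.

Lemma moment_form_gammaD2 (n : nat) a : -1 < a ->
  moment_form n.+1 (gammaD 2) a (olaguerre_coef n ^~ a) (olaguerre_coef n ^~ a)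
  = trigamma (n%:R + a + 1)
    - 2 * moment_form n.+1 (gammaD 1) a
       (laguerre_coef_derivative n n.+1 ^~ a) (olaguerre_coef n ^~ a).
Proof.
move=> a1.
(* - 2 A_n is digamma (n + b + 1), whence the trigamma value. *)
have dA : is_derive a 1 (fun b => - laguerre_connection n n b
    - laguerre_connection n n b) (trigamma (n%:R + a + 1)).
  have -> : (fun b => - laguerre_connection n n b - laguerre_connection n n b)
      = @digamma R \o shift (n%:R + 1).
    apply/funext => b; rewrite /laguerre_connection ltnn eqxx /=.
    have -> : b + (n%:R + 1) = n%:R + b + 1 by ring.
    by field.
  have p : 0 < shift (n%:R + 1) a by rewrite /=; have := ler0n R n; lra.
  apply: is_derive_eq (is_derive1_comp (is_derive_digamma p)
    (is_derive_shift a 1 (n%:R + 1))) _.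
  by rewrite mulr1 /=; congr trigamma; ring.
have d := is_derive_moment_form n.+1 (u := olaguerre_coef n)
  (v := olaguerre_coef n)
  a1 (fun i => is_derive_olaguerre_coef i (ltnSn n) a1)
  (fun i => is_derive_olaguerre_coef i (ltnSn n) a1) (@is_derive_gammaD R 1).
have E : \near a, moment_form n.+1 (gammaD 1) a (olaguerre_coef n ^~ a)
    (olaguerre_coef n ^~ a) = - laguerre_connection n n a
    - laguerre_connection n n a.
  near=> b; rewrite [LHS]moment_form_gammaD1//.
  by near: b; exact: lt_nbhsr.
have [_ e] := near_eq_is_derive E d; have [_ e'] := dA; move: e.
rewrite e' [X in _ = _ + X + _ -> _]moment_formC => ->.
rewrite /laguerre_coef_derivative; ring.
Unshelve. all: end_near. Qed.

End moment_relations.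

(** * The Fisher information *)

Section fisher_information.
Context {R : realType}.
Local Notation mu := (@lebesgue_measure R).
Local Notation posR := (`]0%R, +oo[%classic : set R).
Implicit Types a x : R.

(** Integrability accompanies the value because additivity of the integral of signed functions needs
    it. *)
Definition has_integral_pos (f : R -> R) (v : R) : Prop :=
  mu.-integrable posR (EFin \o f) /\ (\int[mu]_(x in posR) (f x)%:E = v%:E)%E.

Let mp := @measurable_itv R `]0, +oo[.

Lemma has_integral_gamma_kernel (l : nat) (s : R) : 0 < s ->
  has_integral_pos (gamma_kernel l s) (gammaD l s).
Proof. by move=> s0; split; [exact: integrable_gamma_kernel|rewrite
  EFin_gammaD]. Qed.

Lemma has_integral0 : has_integral_pos (cst 0) 0.
Proof.
split; last by rewrite integral0.
exact: (@integrable0 _ _ R mu posR).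
Qed.

Lemma has_integralD (f g : R -> R) (v w : R) : has_integral_pos f v ->
  has_integral_pos g w -> has_integral_pos (f \+ g) (v + w).
Proof.
move=> [fi fv] [gi gw]; split.
  exact: (@integrableD _ _ R mu posR mp _ _ fi gi).
by rewrite EFinD -fv -gw -[RHS](@integralD _ _ R mu posR mp _ _ fi gi).
Qed.

Lemma has_integralZ (c : R) (f : R -> R) (v : R) : has_integral_pos f v ->
  has_integral_pos (fun x => c * f x) (c * v).
Proof.
move=> [fi fv]; split; first exact: (@integrableZl _ _ R mu posR mp c _ fi).
by rewrite EFinM -fv -[RHS](@integralZl _ _ R mu posR mp _ fi).
Qed.

Lemma has_integral_sum (K : nat) (f : 'I_K -> R -> R) (v : 'I_K -> R) :
  (forall k, has_integral_pos (f k) (v k)) ->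
  has_integral_pos (fun x => \sum_(k < K) f k x) (\sum_(k < K) v k).
Proof.
elim: K f v => [|K IH] f v h.
  have -> : (fun x => \sum_(k < 0) f k x) = cst 0.
    by apply/funext => x; rewrite big_ord0.
  by rewrite big_ord0; exact: has_integral0.
have -> : (fun x => \sum_(k < K.+1) f k x) =
    (fun x => \sum_(k < K) f (widen_ord (leqnSn K) k) x) \+ f ord_max.
  by apply/funext => x; rewrite big_ord_recr.
by rewrite big_ord_recr/=; apply: has_integralD; [exact: IH|exact: h].
Qed.

(** For x > 0 the monomial x^(i+j) is absorbed into the kernel, raising its parameter to a + 1 + i +
    j. *)
Lemma has_integral_moment_form (N l : nat) a (u v : nat -> R) : -1 < a ->
  has_integral_pos (fun x => (\sum_(i < N) u i * x ^+ i)
    * (\sum_(j < N) v j * x ^+ j) * gamma_kernel l (a + 1) x)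
    (moment_form N (gammaD l) a u v).
Proof.
move=> a1.
have h : has_integral_pos (fun x => \sum_(i < N) \sum_(j < N)
    u i * v j * gamma_kernel l (a + 1 + (i + j)%:R) x)
    (moment_form N (gammaD l) a u v).
  apply: has_integral_sum => i; apply: has_integral_sum => j.
  apply: has_integralZ; apply: has_integral_gamma_kernel.
  by have := ler0n R (i + j); lra.
have E : {in posR, (fun x => \sum_(i < N) \sum_(j < N)
    u i * v j * gamma_kernel l (a + 1 + (i + j)%:R) x) =1
   (fun x => (\sum_(i < N) u i * x ^+ i)
    * (\sum_(j < N) v j * x ^+ j) * gamma_kernel l (a + 1) x)}.
  move=> x; rewrite inE/= in_itv/= andbT => x0.
  rewrite !mulr_suml; apply: eq_bigr => i _.
  rewrite mulr_sumr mulr_suml; apply: eq_bigr => j _.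
  rewrite /gamma_kernel.
  have -> : a + 1 + (i + j)%:R - 1 = a + 1 - 1 + (i + j)%:R by ring.
  rewrite powRD ?(gt_eqF x0) ?implybT// powR_mulrn ?(ltW x0)// exprD; ring.
case: h => h1 h2; split.
  apply: eq_integrable h1 => //= x xp; congr EFin; exact: E.
rewrite -h2; apply: eq_integral => x xp; congr EFin; exact/esym/E.
Qed.

Lemma is_derive_sqrt_weight a x : 0 < x ->
  is_derive a 1 (fun b => Num.sqrt (expR (- x) * x `^ b))
    (ln x / 2 * Num.sqrt (expR (- x) * x `^ a)).
Proof.
move=> x0.
have d : is_derive a 1 (expR (- x) \*: (@expR R \o ( *%R (ln x)))) 
    (expR (- x) * x `^ a * ln x).
  have dm : is_derive a 1 ( *%R (ln x)) (ln x).
    by apply: is_derive_eq (is_deriveZ (ln x) (is_derive_id a 1)) _;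
      rewrite /GRing.scale/= mulr1.
  apply: is_derive_eq (is_deriveZ _ (is_derive1_comp (is_derive_expR _) dm)) _.
  by rewrite /GRing.scale/= /powR (gt_eqF x0) mulrA (mulrC a).
have E b : (expR (- x) \*: (@expR R \o ( *%R (ln x)))) b = expR (- x) * x `^ b.
  by rewrite /= /powR (gt_eqF x0) (mulrC b).
have -> : (fun b => Num.sqrt (expR (- x) * x `^ b)) =
    Num.sqrt \o (expR (- x) \*: (@expR R \o ( *%R (ln x)))).
  by apply/funext => b; rewrite -E.
have w0 : 0 < expR (- x) * x `^ a by rewrite mulr_gt0 ?expR_gt0 ?powR_gt0.
have p0 : 0 < (expR (- x) \*: (@expR R \o ( *%R (ln x)))) a by rewrite E.
apply: is_derive_eq (is_derive1_comp (is_derive1_sqrt p0) d) _; rewrite E.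
have s0 : Num.sqrt (expR (- x) * x `^ a) != 0 by rewrite gt_eqF// sqrtr_gt0.
(* Writing the weight as the square of its root makes the identity rational in that root. *)
rewrite -[X in _ * (X * _)](sqr_sqrtr (ltW w0)).
by field.
Qed.

Lemma laguerre_fisherE (n : nat) a : -1 < a ->
  laguerre_fisher n a = (2 * (\sum_(k < n) laguerre_connection n k a ^+ 2)
     + trigamma (n%:R + a + 1))%:E.
Proof.
move=> a1.
pose u i := olaguerre_coef n i a.
pose du i := laguerre_coef_derivative n n.+1 i a.
pose F2 := moment_form n.+1 (gammaD 2) a u u.
pose F1 := moment_form n.+1 (gammaD 1) a du u.
pose F0 := moment_form n.+1 (gammaD 0) a du du.
(* The integrand is w (L' + L ln x / 2)^2 with w = e^(-x) x^a; the terms of its expansion in ln^2,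
   ln and 1 go to Gamma'', Gamma' and Gamma. *)
have h := has_integralD (has_integralZ 4^-1 (has_integral_moment_form n.+1 2
  u u a1))
  (has_integralD (has_integral_moment_form n.+1 1 du u a1)
    (has_integral_moment_form n.+1 0 du du a1)).
have e : (\int[mu]_(x in posR)
   ((derive1 (fun b : R => Num.sqrt (expR (- x) * x `^ b) * olaguerre n b x)
        a) ^+ 2)%:E = (4^-1 * F2 + (F1 + F0))%:E)%E.
  case: h => _ <-; apply: eq_integral => x.
  rewrite inE/= in_itv/= andbT => x0; congr EFin.
  have hL := is_derive_olaguerre x (ltnSn n) a1.
  have [_] := is_deriveM (is_derive_sqrt_weight a x0) hL.
  rewrite derive1E => ->.
  have -> : \sum_(k < n.+1) laguerre_connection n k a * olaguerre k a x =
      \sum_(i < n.+1) du i * x ^+ i.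
    under eq_bigr => k _ do rewrite (olaguerreE _ _ (ltn_ord k)) mulr_sumr.
    rewrite exchange_big/=; apply: eq_bigr => i _; rewrite mulr_suml.
    by apply: eq_bigr => k _; rewrite mulrA.
  rewrite (olaguerreE a x (ltnSn n)) -/(u _) /gamma_kernel addrK /GRing.scale/=.
  have w0 : 0 < expR (- x) * x `^ a by rewrite mulr_gt0 ?expR_gt0 ?powR_gt0.
  have := sqr_sqrtr (ltW w0); set S := Num.sqrt _ => S2.
  set dL := \sum_(i < n.+1) _; set L := \sum_(i < n.+1) _.
  transitivity (S ^+ 2 * (dL + L * (ln x / 2)) ^+ 2); first by ring.
  by rewrite S2; field.
rewrite /laguerre_fisher e -EFinM; congr EFin.
rewrite /F2 [moment_form _ (gammaD 2) _ _ _]moment_form_gammaD2// -/F1.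
rewrite [F0]moment_form_gammaD0_dd// [F1]moment_form_gammaD1_d//.
by field.
Qed.

End fisher_information.

(** * The hypergeometric sum *)

Section hypergeometric_sum.
Context {R : realType}.
Implicit Types a y : R.

(** The factors y - m, ..., y taken in reverse order, with the sign of all but y changed. *)
Lemma pochhammer_reflect (m : nat) y :
  pochhammer (y - m%:R) m.+1 = (-1) ^+ m * y * pochhammer (1 - y) m.
Proof.
elim: m => [|m IH].
  by rewrite pochhammerSr !pochhammer0 subr0 addr0 expr0; ring.
rewrite pochhammerSl (_ : y - m.+1%:R + 1 = y - m%:R); last first.
  by rewrite -natr1; ring.
by rewrite IH pochhammerSr exprS -natr1; ring.
Qed.

Lemma pochhammer_fact (k m : nat) :
  k`!%:R * pochhammer (k%:R + 1) m = (k + m)`!%:R :> R.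
Proof.
elim: m => [|m IH]; first by rewrite pochhammer0 mulr1 addn0.
by rewrite pochhammerSr mulrA IH addnS factS natrM -natr1 natrD; ring.
Qed.

Lemma pochhammer1 (m : nat) : pochhammer (1 : R) m = m`!%:R.
Proof. by have := pochhammer_fact 0 m; rewrite fact0 mul1r add0r. Qed.

Lemma pochhammer2 (m : nat) : pochhammer (2 : R) m = m.+1`!%:R.
Proof. by have := pochhammer_fact 1 m; rewrite factS fact0 mul1r. Qed.

Lemma pochhammer_nat_eq0 (n m : nat) : (n <= m)%N -> (0 < n)%N ->
  pochhammer (1 - n%:R : R) m = 0.
Proof.
move=> nm n0; have nm' : (n.-1 < m)%N by rewrite prednK.
(* The factor of index n - 1 is zero. *)
rewrite /pochhammer (bigD1 (Ordinal nm'))//= -{1}(prednK n0) -natr1.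
by rewrite (_ : 1 - _ + _ = 0) ?mul0r//; ring.
Qed.

(** With k = n - 1 - m, d_k^2 / d_n^2 = (k+1)_(m+1) / (a+1+k)_(m+1). Reflecting both symbols, at y =
    n and y = n + a, produces the same sign (-1)^m, which cancels. *)
Lemma sqr_laguerre_connection (n m : nat) a : (m < n)%N -> -1 < a ->
  laguerre_connection n (n - m.+1) a ^+ 2
    = n%:R / (n%:R + a) * (pochhammer (1 - n%:R) m / pochhammer (1 - a -
      n%:R) m)
      / m.+1%:R ^+ 2.
Proof.
move=> mn a1; pose k := (n - m.+1)%N.
have kE : (n = k + m.+1)%N by rewrite /k subnK.
rewrite /laguerre_connection -/k (_ : (k < n)%N);
  last by rewrite kE addnS ltnS leq_addr.
have -> : (n - k = m.+1)%N by rewrite {1}kE addKn.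
rewrite expr_div_n expr_div_n !sqr_laguerre_norm//.
have ak : 0 < a + 1 + k%:R by have := ler0n R k; lra.
have -> : a + 1 + n%:R = a + 1 + k%:R + m.+1%:R by rewrite {1}kE natrD; ring.
have nf : n`!%:R = k`!%:R * pochhammer (k%:R + 1) m.+1 :> R.
  by rewrite pochhammer_fact -kE.
rewrite (Gamma_pochhammer _ ak) nf.
have G0 := lt0r_neq0 (Gamma_gt0 ak).
have f0 : (k`!%:R : R) != 0 by rewrite pnatr_eq0 -lt0n fact_gt0.
have p0 := lt0r_neq0 (pochhammer_gt0 m.+1 ak).
have E1 : a + 1 + k%:R = (n%:R + a) - m%:R by rewrite kE natrD -natr1; ring.
have E2 : k%:R + 1 = n%:R - m%:R :> R by rewrite kE natrD -natr1; ring.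
have E3 : 1 - a - n%:R = 1 - (n%:R + a) by ring.
have s0 : (-1) ^+ m != 0 :> R by rewrite expf_neq0// oppr_eq0 oner_eq0.
rewrite E2 E3 pochhammer_reflect.
have pE : pochhammer (a + 1 + k%:R) m.+1
    = (-1) ^+ m * (n%:R + a) * pochhammer (1 - (n%:R + a)) m.
  by rewrite E1 pochhammer_reflect.
rewrite pE; move: p0; rewrite pE !mulf_eq0 !negb_or => /andP[/andP[_ na0] q0].
have nP : n%:R != 0 :> R by rewrite pnatr_eq0 -lt0n (leq_ltn_trans _ mn).
(* [field] divides by this factor; in the case where it is 0, both sides reduce to 0 by the
   convention on inverses. *)
have [->|P0] := eqVneq (pochhammer (1 - n%:R : R) m) 0.
  by rewrite !(mulr0, mul0r, invr0).
by field; rewrite nat1r pnatr_eq0 q0 na0 P0 nP s0 f0 G0 /=.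
Qed.

Lemma hypergeometric_laguerre (n : nat) a : (0 < n)%N -> -1 < a ->
  2 * n%:R / (n%:R + a) * hypergeometric [:: 1; 1; 1; 1 - n%:R]
                             [:: 2; 2; 1 - a - n%:R] 1
  = 2 * \sum_(k < n) laguerre_connection n k a ^+ 2.
Proof.
move=> n0 a1; rewrite /hypergeometric.
set t := (fun m : nat => _).
(* Two quotients (1)_m / (2)_m give 1 / (m+1)^2 and the third (1)_m cancels m!. *)
have tE m : t m = pochhammer (1 - n%:R) m / pochhammer (1 - a - n%:R) m /
  m.+1%:R ^+ 2.
  rewrite /t !big_cons !big_nil !pochhammer1 !pochhammer2 !mulr1 expr1n factS
    natrM.
  have f0 : (m`!%:R : R) != 0 by rewrite pnatr_eq0 -lt0n fact_gt0.
  (* For natural a this symbol vanishes at large m, so its inverse is kept opaque. *)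
  rewrite !invfM; set p := (pochhammer (1 - a - _) _)^-1.
  by field; rewrite nat1r pnatr_eq0 f0 /=.
(* The partial sums are constant from n on, by the factor (1 - n)_m. *)
have -> : limn (series t) = \sum_(m < n) t m.
  apply/cvg_lim => //; apply: cvg_near_cst; near=> k.
  have nk : (n <= k)%N by near: k; exact: nbhs_infty_ge.
  rewrite /series/= (big_cat_nat (n := n))//= [X in _ + X]big_nat_cond.
  rewrite [X in _ + X]big1 ?addr0 ?big_mkord// => m /andP[/andP[nm _] _].
  by rewrite tE pochhammer_nat_eq0// !mul0r.
rewrite -!mulrA; congr (_ * _); rewrite mulrA mulr_sumr.
rewrite [RHS](reindex_inj rev_ord_inj)/=; apply: eq_bigr => m _.
by rewrite sqr_laguerre_connection// tE mulrA.
Unshelve. all: end_near. Qed.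

End hypergeometric_sum.

Theorem corollary1 (R : realType) (n : nat) (alpha : R) (halpha : -1 < alpha) :
  laguerre_fisher n alpha
    = (2 * (\sum_(k < n) laguerreA n k alpha ^+ 2)
        - 2 * derive1 (@laguerreA R n n) alpha)%:E
  /\
  2 * (\sum_(k < n) laguerreA n k alpha ^+ 2)
    - 2 * derive1 (@laguerreA R n n) alpha
  = trigamma (n%:R + alpha + 1)
    + (if n == 0%N then 0
       else 2 * n%:R / (n%:R + alpha)
            * hypergeometric [:: 1; 1; 1; 1 - n%:R]
                             [:: 2; 2; 1 - alpha - n%:R] 1).
Proof.
have -> : derive1 (@laguerreA R n n) alpha = - (trigamma (n%:R + alpha + 1) /
  2).
  rewrite derive1E.
  have p : 0 < shift (n%:R + 1) alpha by rewrite /=; have := ler0n R n; lra.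
  have d := is_deriveZ (- 2^-1) (is_derive1_comp (is_derive_digamma p)
    (is_derive_shift alpha 1 (n%:R + 1))).
  (* The closed form of [laguerreA] holds for parameters above -1, so the derivative is transferred
     through equality near alpha. *)
  have E : \near alpha, (- 2^-1 \*: (@digamma R \o shift (n%:R + 1))) alpha
      = laguerreA n n alpha.
    near=> b; rewrite laguerreAE//; last by near: b; exact: lt_nbhsr.
    rewrite /laguerre_connection ltnn eqxx /=.
    have -> : b + (n%:R + 1) = n%:R + b + 1 by ring.
    by rewrite /GRing.scale/=; field.
  have [_ e] := near_eq_is_derive E d.
  transitivity (- 2^-1 * trigamma (shift (n%:R + 1) alpha)).
    by rewrite -[trigamma _]mulr1; exact: e.
  have -> : shift (n%:R + 1) alpha = n%:R + alpha + 1 by rewrite /=; ring.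
  by field.
have -> : \sum_(k < n) laguerreA n k alpha ^+ 2 =
    \sum_(k < n) laguerre_connection n k alpha ^+ 2.
  by apply: eq_bigr => k _; rewrite laguerreAE// ltnW.
split; first by rewrite laguerre_fisherE//; congr EFin; field.
have [->|n0] := eqVneq n 0%N; first by rewrite big_ord0; field.
by rewrite hypergeometric_laguerre ?lt0n//; field.
Unshelve. all: end_near. Qed.
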